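(* Let $m,n\ge1$ and $\bm\mu,\bm\nu\in\mathcal P_{n,m}$. Then $$\mathrm{mbtr}_1(\bm\mu,\bar{\bm\nu})=\sum_{\bm\lambda\in\mathcal P_{n,m}}\phi^{\bm\lambda}_{\bm\mu}\,\overline{\phi^{\bm\lambda}_{\bm\nu}}=\delta_{\bm\mu,\bm\nu}\,m^{l(\bm\mu)}\prod_{i=1}^mz_{\mu^{(i)}},$$ where $\phi^{\bm\lambda}_{\bm\mu}=\phi^{\bm\lambda}(w(\bm\mu))$, the $\phi^{\bm\lambda}$ ($\bm\lambda\in\mathcal P_{n,m}$) being the irreducible complex characters of the complex reflection group $\mathscr W_{m,n}$ of type $G(m,1,n)$, and $z_\lambda=\prod_{i\ge1}i^{m_i(\lambda)}m_i(\lambda)!$ with $m_i(\lambda)$ the number of parts of $\lambda$ equal to $i$.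
   Context: $\mathcal P_{n,m}$ is the set of $m$-tuples $\bm\mu=(\mu^{(1)},\dots,\mu^{(m)})$ of partitions of total size $n$; $l(\bm\mu)=\sum_il(\mu^{(i)})$. $\mathscr W_{m,n}=(\mathbb Z/m\mathbb Z)^n\rtimes\mathfrak S_n$ is generated by $s_1,\dots,s_n$ with relations $s_1^m=1$, $s_i^2=1$ ($i\ge2$), $s_1s_2s_1s_2=s_2s_1s_2s_1$, $s_is_j=s_js_i$ ($|i-j|>1$), $s_is_{i+1}s_i=s_{i+1}s_is_{i+1}$ ($2\le i<n$); $s_i$ ($i\ge 2$) is the transposition $(i-1,i)$. Put $t_1=s_1$, $t_i=s_it_{i-1}s_i$ (the generators of the cyclic factors). The element $w(\bm\mu)$: list the parts of $\bm\mu$ as $\mu^{(1)}_1,\mu^{(1)}_2,\dots,\mu^{(2)}_1,\dots$ and cut $\{1,\dots,n\}$ into consecutive blocks of these sizes; to a part of size $a$ of $\mu^{(i)}$ occupying $\{b+1,\dots,b+a\}$ associate $t_{b+a}^{\,i-1}s_{b+a}s_{b+a-1}\cdots s_{b+2}$; $w(\bm\mu)$ is the product of these commuting elements. The irreducible characters of $\mathscr W_{m,n}$ are indexed by $\mathcal P_{n,m}$. $\mathrm{mbtr}_1(\bm\mu,\bar{\bm\nu})$ is the trace of the linear map $x\mapsto w(\bm\mu)\,x\,w(\bm\nu)^{-1}$ on the group algebra $\mathbb C[\mathscr W_{m,n}]$. *)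

(* Defs.v *)
From HB Require Import structures.
From mathcomp Require Import all_boot all_order all_fingroup all_algebra.
From mathcomp Require Import all_solvable all_field all_character.

Set Implicit Arguments.
Unset Strict Implicit.
Unset Printing Implicit Defensive.

Import Order.TTheory GroupScope GRing.Theory Num.Theory.

Definition is_partition (p : seq nat) : bool := sorted geq p && (0 \notin p).

Section Multipartitions.

Variables n m : nat.

Definition is_mpartition (mu : m.-tuple (seq nat)) : bool :=
  all is_partition mu && (\sum_(i < m) sumn (tnth mu i) == n).

Record mpartition :=
  MPartition { mpart :> m.-tuple (seq nat); _ : is_mpartition mpart }.

HB.instance Definition _ := [isSub for mpart].
HB.instance Definition _ := [Countable of mpartition by <:].

Fact partition_bounds p : is_partition p ->
  size p <= sumn p /\ {in p, forall a, a <= sumn p}.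
Proof.
case/andP=> _; elim: p => //= a p IHp.
rewrite inE negb_or eq_sym -lt0n => /andP[a_gt0 /IHp[szp lep]].
split=> [|b]; first by rewrite -add1n leq_add.
rewrite inE => /predU1P[-> | /lep le_b]; first exact: leq_addr.
exact: leq_trans le_b (leq_addl _ _).
Qed.

Definition mpart_code (mu : mpartition) : m.-tuple (n.-bseq 'I_n.+1) :=
  [tuple insub_bseq n [seq inord a | a <- tnth mu i] | i < m].

Definition mpart_decode (t : m.-tuple (n.-bseq 'I_n.+1)) : option mpartition :=
  insub [tuple [seq val a | a <- tnth t i] | i < m].

Fact mpart_codeK : pcancel mpart_code mpart_decode.
Proof.
move=> mu; rewrite /mpart_decode.
set t := (X in insub X); suff -> : t = mu by rewrite valK.
apply: eq_from_tnth => i; rewrite !tnth_mktuple.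
case: mu @t => mu /= /andP[/all_tnthP/(_ i) mu_i /eqP mu_n].
have [sz_i le_i] := partition_bounds mu_i.
have le_n : sumn (tnth mu i) <= n by rewrite -mu_n (bigD1 i) //= leq_addr.
rewrite /insub_bseq /insubd insubT ?size_map ?(leq_trans sz_i) //= => _.
rewrite -map_comp -[RHS]map_id; apply/eq_in_map => a /le_i le_a /=.
by rewrite inordK // ltnS (leq_trans le_a).
Qed.

HB.instance Definition _ : isFinite mpartition := PCanIsFinite mpart_codeK.

End Multipartitions.

Definition mlength n m (mu : mpartition n m) : nat :=
  \sum_(i < m) size (tnth mu i).

(* The factors with i > |p| are 1. *)
Definition zpart (p : seq nat) : nat :=
  \prod_(1 <= i < (sumn p).+1) (i ^ count_mem i p * (count_mem i p)`!).

Section WreathProduct.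

Variables m n : nat.

(* (Z/mZ)^n, written additively. For 0 < m, 'I_m.-1.+1 is 'I_m, the integers  *)
(* mod m; unlike 'Z_m this is also right for m = 1.                           *)
Definition cycpow : predArgType := {ffun 'I_n -> 'I_m.-1.+1}.

HB.instance Definition _ := GRing.Zmodule.on cycpow.
HB.instance Definition _ := Finite.on cycpow.
HB.instance Definition _ := [finGroupMixin of cycpow for +%R].

(* The right action of 'S_n that moves the coordinate k to position a k. *)
Definition cycpow_act (x : cycpow) (a : 'S_n) : cycpow :=
  [ffun k => x (a^-1 k)].

Fact cycpow_act1 : cycpow_act^~ 1 =1 id.
Proof. by move=> x; apply/ffunP => k; rewrite ffunE invg1 perm1. Qed.

Fact cycpow_actM x : act_morph cycpow_act x.
Proof. by move=> a b; apply/ffunP => k; rewrite !ffunE invMg permM. Qed.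

Canonical cycpow_action := TotalAction cycpow_act1 cycpow_actM.

Fact cycpow_is_groupAction : is_groupAction [set: cycpow] cycpow_action.
Proof.
move=> a _; rewrite inE; apply/andP; split.
  by apply/subsetP => x _; rewrite inE.
by apply/morphicP => x y _ _; rewrite !permE; apply/ffunP => k; rewrite !ffunE.
Qed.

Canonical cycpow_groupAction := GroupAction cycpow_is_groupAction.

Definition wreath : finGroupType := sdprod_by cycpow_groupAction.

(* Generators and blocks are numbered from 1, ordinals from 0: the position j *)
(* of {1, .., n} is the ordinal j.-1. The values outside 1 <= j <= n are      *)
(* irrelevant.                                                                *)
Definition sgen (j : nat) : wreath :=
  if j == 1%N then
    sdpair1 cycpow_groupAction [ffun k : 'I_n => inZp (val k == 0)]
  else if (insub j.-2, insub j.-1) is (Some k, Some l) then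
    sdpair2 cycpow_groupAction (tperm k l)
  else 1.

Fixpoint tgen (j : nat) : wreath :=
  match j with
  | 0 => 1
  | 1%N => sgen 1
  | j'.+1 => sgen j * tgen j' * sgen j
  end.

(* t_(b+a)^c s_(b+a) s_(b+a-1) .. s_(b+2) *)
Definition wblock (b c a : nat) : wreath :=
  tgen (b + a) ^+ c * \prod_(j <- rev (iota b.+2 a.-1)) sgen j.

(* A pair (c, a) stands for a part a of the component of (0-based) index c. *)
Fixpoint wblocks (b : nat) (s : seq (nat * nat)) : wreath :=
  if s is (c, a) :: s' then wblock b c a * wblocks (b + a) s' else 1.

Definition wmu (mu : mpartition n m) : wreath :=
  wblocks 0 [seq (val i, a) | i <- enum 'I_m, a <- tnth mu i].

End WreathProduct.

Section GroupAlgebra.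

Local Open Scope ring_scope.

Variable gT : finGroupType.

(* C[gT], as the space of functions on gT with the convolution product; algC  *)
(* is the field of complex numbers over which the characters of finite groups *)
(* are defined in the library.                                                *)
Definition galg : vectType algC := {ffun gT -> algC^o}.

Definition galg_of (g : gT) : galg := [ffun h => (h == g)%:R].

Definition galg_mul (x y : galg) : galg :=
  [ffun g => \sum_(h : gT) x h * y (h^-1 * g)%g].

Definition bimul (a b : gT) (x : galg) : galg :=
  galg_mul (galg_mul (galg_of a) x) (galg_of b).

Fact bimul_is_linear a b : linear (bimul a b).
Proof.
move=> c x y; apply/ffunP => g; rewrite !ffunE scaler_sumr -big_split /=.
apply: eq_bigr => h _; rewrite !ffunE /GRing.scale /= mulrA -mulrDl mulr_sumr.
rewrite -big_split /=; congr (_ * _); apply: eq_bigr => k _.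
by rewrite !ffunE mulrDr mulrCA.
Qed.

HB.instance Definition _ a b :=
  GRing.isSemilinear.Build algC galg galg _ (bimul a b)
    (GRing.semilinear_linear (bimul_is_linear a b)).

End GroupAlgebra.

Definition lfun_trace (F : fieldType) (V : vectType F) (f : 'End(V)) : F :=
  \tr (passmx.mxof (vbasis fullv) (vbasis fullv) f).

Definition mbtr1 m n (mu nu : mpartition n m) : algC :=
  lfun_trace (linfun (bimul (wmu mu) (wmu nu)^-1)).

(* Main.v *)
(** Both sums count the centralizer of w(mu). The map x |-> a x b^-1 permutes
the basis of the group algebra, so its trace is the number of x with a x = x b,
which is |C(a)| if a and b are conjugate and 0 otherwise; the second
orthogonality relation gives the same value for the sum over the characters.

Let the wreath product W act on the mn points (k, d), k < n, d in Z/m. Then W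
is the full centralizer of z : (k, d) |-> (k, d + 1), so C_W(w) is the
centralizer in the symmetric group of the abelian group A = <z, w>. For
w = w(mu), each part a of mu^(i) gives one A-orbit, of size m a, and the
stabilizers of two points agree iff their orbits come from equal parts of the
same component. A permutation commuting with A permutes the orbits with a given
stabilizer, and by a chain of point stabilizers |C(A)| is the product of the
orbit sizes and of the factorials of the multiplicities. The number of points
with a given label (i, a) is a class function of w, so w(mu) determines mu. *)
Require Import Defs.
From HB Require Import structures.
From mathcomp Require Import all_boot all_order all_fingroup all_algebra.
From mathcomp Require Import all_solvable all_field all_character.
From mathcomp Require Import zify.

Set Implicit Arguments.
Unset Strict Implicit.
Unset Printing Implicit Defensive.

Import Order.TTheory GRing.Theory Num.Theory.
Local Open Scope ring_scope.

(** * Trace of two-sided multiplication on the group algebra *)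

Section BimulTrace.

Variable gT : finGroupType.

(** The trace is defined through the abstract basis [vbasis fullv]. Expanding its vectors in the
    functions [galg_of g], and the images [f (galg_of g)] back in [vbasis], gives a double sum whose
    exchange yields the trace in the natural basis. *)
Lemma galg_trace (f : 'End(galg gT)) :
  lfun_trace f = \sum_g f (galg_of g) g.
Proof.
rewrite /lfun_trace /mxtrace; set e := vbasis _.
have fE i : f e`_i = \sum_g e`_i g *: f (galg_of g).
  have {1}->: e`_i = \sum_g e`_i g *: galg_of g.
    apply/ffunP=> h; rewrite sum_ffunE (bigD1 h) //= big1 => [|g].
      by rewrite !ffunE eqxx addr0 /GRing.scale /= mulr1.
    by rewrite eq_sym => /negPf gh; rewrite !ffunE gh scaler0.
  by rewrite linear_sum; apply: eq_bigr => g _; rewrite linearZ.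
under eq_bigr => i _.
  rewrite !mxE /= /passmx.vecof (bigD1 i) //=.
  rewrite big1 => [|j /negPf ji]; last first.
    by rewrite mxE ji andbF scale0r.
  rewrite mxE !eqxx scale1r addr0 fE linear_sum.
  over.
rewrite exchange_big; apply: eq_bigr => g _ /=.
rewrite [in RHS](coord_vbasis (memvf (f (galg_of g)))) sum_ffunE.
apply: eq_bigr => i _; rewrite linearZ !ffunE /GRing.scale /=.
by rewrite mulrC.
Qed.

Lemma bimul_galg_of (a b g : gT) :
  bimul a b (galg_of g) = galg_of (a * g * b)%g.
Proof.
have mulE (x y : gT) : galg_mul (galg_of x) (galg_of y) = galg_of (x * y)%g.
  apply/ffunP=> h; rewrite !ffunE (bigD1 x) //= big1 => [|k /negPf kx].
    by rewrite !ffunE eqxx mul1r addr0 -(inj_eq (mulgI x)) mulKVg.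
  by rewrite !ffunE kx mul0r.
by rewrite /bimul !mulE.
Qed.

(** The diagonal entries count the [g] with [a g = g b]. If [a = b ^ x] they form the right coset of
    ['C[a]] by [x^-1]; any such [g] conversely conjugates [a] to [b]. *)
Lemma bimul_trace (a b : gT) :
  lfun_trace (linfun (bimul a b^-1)) =
    #|'C[a]%g|%:R *+ (a \in b ^: [set: gT])%g.
Proof.
rewrite galg_trace.
under eq_bigr => g _ do rewrite lfunE /= bimul_galg_of ffunE.
rewrite -natr_sum -[RHS]mulr_natr -natrM; congr _%:R.
transitivity #|[set g : gT | g == a * g * b^-1]%g|.
  by rewrite -sum1dep_card [RHS]big_mkcond; apply: eq_bigr => g _;
    case: (_ == _).
have [/imsetP[x _ ->] | nconj] := boolP (a \in _).
  rewrite muln1 -(card_rcoset 'C[_]%g x^-1); apply: eq_card => g.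
  rewrite mem_rcoset invgK cent1E inE conjgE (canF_eq (mulgK _)) !mulgA.
  by rewrite !invMg invgK !mulgA mulgK (inj_eq (mulIg _)).
rewrite muln0; apply/eqP; rewrite cards_eq0; apply/eqP/setP => g; rewrite !inE.
apply/negbTE; apply: contra nconj => /eqP gE; apply/imsetP.
have ag : (a * g = g * b)%g by rewrite {2}gE mulgKV.
by exists g^-1%g; rewrite ?inE // conjgE invgK mulgA -ag mulgK.
Qed.

End BimulTrace.

(** * The centralizer of an abelian permutation group *)

Section AbelianCentralizer.

Local Open Scope group_scope.
Local Open Scope nat_scope.

Variables (T : finType) (A : {group {perm T}}).
Hypothesis abA : abelian A.

Local Notation orb := (orbit 'P A).
Local Notation stab x := 'C_A[x | 'P].

Lemma abelian_perm_orbit_stab x y : y \in orb x -> stab y = stab x.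
Proof.
case/orbitP=> a Aa <-; apply/setP=> b; rewrite !inE !sub1set !inE /= /aperm.
case Ab: (b \in A) => //=.
by rewrite -permM (centsP abA _ Aa _ Ab) permM (inj_eq perm_inj).
Qed.

(** This makes the map [a x |-> a y] between two orbits with the same stabilizer well defined. *)
Lemma eq_stab_perm x y a b : stab x = stab y -> a \in A -> b \in A ->
  a x = b x -> a y = b y.
Proof.
move=> sxy Aa Ab axy; apply: (canRL (permKV b)); rewrite -permM.
apply/(@astab1P _ _ 'P); suff: (a * b^-1)%g \in stab y by case/setIP.
rewrite -sxy inE groupM ?groupV //; apply/astab1P.
by rewrite /= /aperm permM axy permK.
Qed.

(* Either a restriction of an element of A, or the swap of the two orbits. *)
Lemma cent_transport x y : stab x = stab y ->
  exists p, [/\ p \in 'C(A), perm_on (orb x :|: orb y) p & p x = y].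
Proof.
move=> sxy; have [/orbitP[a Aa axy] | nxy] := boolP (y \in orb x).
  exists (restr_perm (orb x) a).
  have Na : a \in 'N(orb x | 'P) by apply/astabsP=> u; rewrite orbit_actr.
  split; last by rewrite restr_permE // orbit_refl.
    apply/centP=> b Ab; apply/permP=> u; rewrite !permM.
    have ob : (b u \in orb x) = (u \in orb x) := orbit_actr _ _ _ Ab.
    case: (boolP (u \in orb x)) => ux; last first.
      by rewrite !(out_perm (restr_perm_on _ _)) ?ob.
    by rewrite !restr_permE ?ob // -!permM (centsP abA _ Aa _ Ab).
  by apply: subset_trans (restr_perm_on _ _) (subsetUl _ _).
(* The swap sends [a x] to [a y] and back, and fixes everything else. By [eq_stab_perm] its values
   do not depend on the elements picked. *)
pose f u := if [pick a in A | a x == u] is Some a then a y else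
            if [pick a in A | a y == u] is Some a then a x else u.
have fx a : a \in A -> f (a x) = a y.
  rewrite /f => Aa; case: pickP => [b /andP[Ab /eqP bx] | /(_ a)].
    exact: eq_stab_perm bx.
  by rewrite Aa eqxx.
have fy a : a \in A -> f (a y) = a x.
  (* The first [pick] cannot succeed at [a y], since [y] would then lie in the orbit of [x]. *)
  rewrite /f => Aa; case: pickP => [b /andP[Ab /eqP bx] | _].
    case/negP: nxy; rewrite -(orbit_actr _ _ _ Aa).
    by rewrite (_ : 'P%act y a = 'P%act x b) ?mem_orbit.
  case: pickP => [b /andP[Ab /eqP bx] | /(_ a)].
    by apply: eq_stab_perm bx.
  by rewrite Aa eqxx.
have fo u : u \notin orb x :|: orb y -> f u = u.
  rewrite inE negb_or /f => /andP[ux uy].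
  case: pickP => [b /andP[Ab /eqP bu] | _].
    by case/orbitP: ux; exists b.
  case: pickP => [b /andP[Ab /eqP bu] | //].
  by case/orbitP: uy; exists b.
have fP u : [\/ exists2 a, a \in A & u = a x, exists2 a, a \in A & u = a y
             | u \notin orb x :|: orb y].
  have [/setUP[] /orbitP[a Aa <-] | nu] := boolP (u \in orb x :|: orb y).
  - by constructor 1; exists a.
  - by constructor 2; exists a.
  - by constructor 3.
have ff : involutive f.
  move=> u; case: (fP u) => [[a Aa ->]|[a Aa ->]|nu].
  - by rewrite fx ?fy.
  - by rewrite fy ?fx.
  - by rewrite !fo.
exists (perm (inv_inj ff)); split.
- apply/centP=> b Ab; apply/permP=> u; rewrite !permM !permE.
  case: (fP u) => [[a Aa ->]|[a Aa ->]|nu].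
  - by rewrite fx // -!permM fx ?groupM.
  - by rewrite fy // -!permM fy ?groupM.
  have ob v : (b u \in orb v) = (u \in orb v) := orbit_actr _ _ _ Ab.
  by rewrite !fo // inE !ob -in_setU.
- by apply/subsetP=> u; apply: contraR => nu; rewrite permE fo.
- by rewrite permE -{1}[x]perm1 fx ?perm1.
Qed.

Variables (L : eqType) (lab : T -> L) (sz : L -> nat).
Hypothesis labP : forall x y, lab x = lab y <-> stab x = stab y.
Hypothesis szP : forall x, #|orb x| = sz (lab x).

Definition orbs (s : seq T) := [set y | has (fun x => y \in orb x) s].

Lemma orbs_cons x s : orbs (x :: s) = orb x :|: orbs s.
Proof. by apply/setP=> y; rewrite !inE. Qed.

Lemma orbs_cons_disjoint x s : all (fun y => y \notin orb x) s ->
  orb x :&: orbs s = set0.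
Proof.
move=> /allP xs; apply/setP=> z; rewrite !inE; apply/negbTE/andP=> -[zx].
case/hasP=> y sy zy; case/negP: (xs y sy).
have /orbit_eqP <- := zx; have /orbit_eqP -> := zy.
exact: orbit_refl.
Qed.

(** Labels are constant on orbits, so each listed orbit with label [l] contributes all of its [sz l]
    points. *)
Lemma card_orbs_lab s l : pairwise (fun x y => y \notin orb x) s ->
  #|[set y in orbs s | lab y == l]| = count_mem l (map lab s) * sz l.
Proof.
elim: s => [_|x s IHs] /=.
  by apply/eqP; rewrite cards_eq0; apply/eqP/setP=> y; rewrite !inE.
case/andP=> xs /IHs{}IHs; rewrite mulnDl -IHs.
have labx y : y \in orb x -> lab y = lab x.
  by move/abelian_perm_orbit_stab/labP.
rewrite -(cardsID (orb x)); congr (_ + _).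
  have [<-|nxl] := eqVneq (lab x) l; last first.
    apply/eqP; rewrite mul0n cards_eq0; apply/eqP/setP=> y.
    rewrite !inE; apply/negbTE/andP=> -[/andP[_ /eqP yl] /labx xy].
    by rewrite -xy yl eqxx in nxl.
  rewrite mul1n -szP.
  apply: (congr1 (fun B : {set T} => #|B|)); apply/setP=> y.
  rewrite orbs_cons !inE.
  by case yx: (y \in orb x); rewrite ?andbF //= labx ?eqxx.
apply: eq_card => y; rewrite orbs_cons !inE.
case yx: (y \in orb x) => //=.
have /setP/(_ y) := orbs_cons_disjoint xs.
by rewrite !inE yx /= => ->.
Qed.

(** Induction along the orbit representatives, with the orbit-stabilizer theorem at the head of the
    list. The list [L0] stays fixed, so the product of factorials ranges over the same labels at
    each step; a label absent from [s] contributes [0! = 1]. *)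
Lemma card_cent_orbs s : pairwise (fun x y => y \notin orb x) s ->
  forall L0, uniq L0 -> {subset map lab s <= L0} ->
  #|'C(A) :&: perm.Sym (orbs s)| =
  (\prod_(l <- map lab s) sz l) * \prod_(l <- L0) (count_mem l (map lab s))`!.
Proof.
elim: s => [_|x s IHs] /= => [L0 _ _|/andP[xs s_pw] L0 uL0 sL0].
  rewrite big_nil big1_seq // muln1; apply/eqP/cards1P; exists 1%g.
  apply/setP=> p; rewrite !inE; apply/andP/eqP=> [[_ /subsetP ps]|->].
    apply/permP=> u; rewrite perm1; apply/eqP.
    by apply: contraT => /ps; rewrite inE.
  by rewrite group1 perm_on1.
have {}IHs := IHs s_pw L0 uL0 (fun l => sL0 l \o @mem_behead _ (_ :: _) l).
have pw : pairwise (fun x y => y \notin orb x) (x :: s) by rewrite /= xs.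
pose G := ('C(A) :&: perm.Sym (orbs (x :: s)))%G.
(* A permutation that commutes with [A] and fixes [x] fixes every [a x], so it moves only points of
   the remaining orbits. *)
have stabG : 'C_G[x | 'P] = 'C(A) :&: perm.Sym (orbs s).
  apply/setP=> p; rewrite !inE sub1set inE /= /aperm orbs_cons.
  case Cp: (p \in 'C(A)) => //=; apply/andP/idP=> [[/subsetP ps /eqP px]|ps].
    apply/subsetP=> u pu; move: (ps u pu); rewrite inE => /orP[] //.
    case/orbitP=> a Aa au; move: pu; rewrite !inE -au /= /aperm.
    by rewrite -permM -(centP Cp _ Aa) permM px eqxx.
  split; first exact: subset_trans ps (subsetUr _ _).
  rewrite (out_perm ps) //; apply/negP=> xs'.
  by have /setP/(_ x) := orbs_cons_disjoint xs;
    rewrite in_setI orbit_refl xs' in_set0.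
(* Commuting with [A] preserves stabilizers, hence labels; conversely [cent_transport] reaches every
   point with the label of [x]. *)
have orbG : orbit 'P G x = [set y in orbs (x :: s) | lab y == lab x].
  apply/setP=> y; rewrite inE; apply/orbitP/andP=> [[p]|[ys /eqP/labP sy]].
    case/setIP=> Cp; rewrite inE => ps <-; split.
      by rewrite /= /aperm perm_closed // orbs_cons inE orbit_refl.
    apply/eqP/labP/setP=> a; rewrite !inE !sub1set !inE /= /aperm.
    case Aa: (a \in A) => //=.
    by rewrite -permM (centP Cp _ Aa) permM (inj_eq perm_inj).
  have [p [Cp ps px]] := cent_transport (esym sy); exists p => //.
  rewrite inE Cp inE; apply: subset_trans ps _; rewrite orbs_cons.
  rewrite subUset subsetUl /=; move: ys; rewrite orbs_cons inE.
  case/orP=> [/orbit_eqP-> |]; first exact: subsetUl.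
  rewrite inE => /hasP[z sz_ yz]; apply/subsetP=> u uy; rewrite !inE.
  apply/orP; right; apply/hasP; exists z => //; exact: orbit_trans uy yz.
rewrite -(card_orbit_stab 'P G x) stabG IHs orbG card_orbs_lab //= eqxx.
set S := map lab s in sL0 *; have Lx : lab x \in L0 by rewrite sL0 ?mem_head.
(* Adding [x] raises one multiplicity by 1, so one factorial gains a factor: the number of orbits to
   which that of [x] can be sent. *)
have -> : \prod_(l <- L0) ((lab x == l) + count_mem l S)`! =
          (1 + count_mem (lab x) S) * \prod_(l <- L0) (count_mem l S)`!.
  rewrite !(bigD1_seq (lab x)) //= eqxx add1n factS -mulnA.
  by congr (_ * (_ * _)); apply: eq_bigr => l; rewrite eq_sym => /negPf->.
by rewrite big_cons [X in X * _ = _]mulnC mulnACA.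
Qed.

(** The list [S] need not come from an orbit transversal: the number of points with each label
    already forces it to be a permutation of the labels of one. *)
Lemma card_cent_abelian_perm (S L0 : seq L) :
    (forall l, #|[set x | lab x == l]| = count_mem l S * sz l) ->
    {in S, forall l, 0 < sz l} -> uniq L0 -> {subset S <= L0} ->
  #|'C(A)| =
  (\prod_(l <- S) sz l) * \prod_(l <- L0) (count_mem l S)`!.
Proof.
move=> cardS szS uL0 sSL0.
have nT : [acts A, on [set: T] | 'P] by apply/actsP=> a _ x; rewrite !inE.
have [_ _ X_inj X_cover] := orbit_transversalP nT.
set X := orbit_transversal _ _ _ in X_inj X_cover.
have pw : pairwise (fun x y => y \notin orb x) (enum X).
  apply: (@sub_in_pairwise _ (mem X) [rel x y | x != y]) => [x y Xx Xy /=||].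
  - by rewrite X_inj.
  - by apply/allP=> x; rewrite mem_enum.
  - by rewrite -uniq_pairwise enum_uniq.
have orbsX : orbs (enum X) = setT.
  apply/setP=> x; rewrite !inE; apply/hasP; have [//|a Aa Xa] := X_cover x.
  by exists ('P%act x a); rewrite ?mem_enum // orbit_sym mem_orbit.
have eqS : perm_eq (map lab (enum X)) S.
  apply/allP=> l; rewrite mem_cat => l_in /=.
  (* Positivity lets the orbit size be cancelled from the two counts of points labelled [l]. *)
  have sz0 : 0 < sz l.
    case/orP: l_in => [/mapP[x _ ->]|/szS//].
    by rewrite -szP; apply/card_gt0P; exists x; apply: orbit_refl.
  rewrite -(eqn_pmul2r sz0) -card_orbs_lab // -cardS orbsX.
  by apply/eqP; apply: eq_card => x; rewrite !inE.
have := card_cent_orbs pw uL0; rewrite orbsX.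
rewrite (setIidPl _); last first.
  by apply/subsetP=> p _; rewrite inE; apply/subsetP=> x; rewrite inE.
move=> ->; last by move=> l; rewrite (perm_mem eqS) => /sSL0.
congr (_ * _); first exact: perm_big.
by apply: eq_bigr => l _; rewrite (seq.permP eqS).
Qed.

End AbelianCentralizer.

(** * The wreath product as the centralizer of a permutation [zrot] *)

Section WreathPoints.

Local Open Scope group_scope.

Variables m n : nat.

Local Notation W := (wreath m n).
Local Notation Zm := 'I_m.-1.+1.

(* The mn points of the monomial representation: (k, d) is the basis vector   *)
(* e_k multiplied by the d-th power of a primitive m-th root of unity.        *)
Local Notation wpoint := ('I_n * Zm)%type.

(** The permutation [a] acts first, so [f] is read at the new position [a p.1]; this order fits the
    product of the semidirect product. *)
Definition wact (p : wpoint) (u : W) : wpoint :=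
  let: (a, f) := pair_of_sd u in (a p.1, (p.2 + f (a p.1))%R).

Fact wact1 : wact^~ 1 =1 id.
Proof. by case=> k d; rewrite /wact /= perm1 ffunE addr0. Qed.

Fact wactM p : act_morph wact p.
Proof.
move=> u v; rewrite /wact /=; case: u v => [[a f] ?] [[b g] ?] /=.
by rewrite !ffunE /= permM /cycpow_act permK addrA.
Qed.

Canonical wact_action := TotalAction wact1 wactM.

Definition wperm : W -> {perm wpoint} := actperm wact_action.

Canonical wperm_morphism := [morphism of wperm].

Lemma wpermE u p : wperm u p = wact p u.
Proof. exact: actpermE. Qed.

Lemma wperm_inj : 'injm wperm.
Proof.
apply/injmP=> u v _ _ uv; apply: val_inj.
have {}uv p : wact p u = wact p v by rewrite -!wpermE uv.
case: u v uv => [[a f] ?] [[b g] ?] /= uv.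
have ab : a = b by apply/permP=> k; have [] := uv (k, 0%R).
subst b; congr (_, _); apply/ffunP=> k; have /(congr1 snd) := uv (a^-1 k, 0%R).
by rewrite /= permKV !add0r.
Qed.

Definition zrot_fun (p : wpoint) : wpoint := (p.1, (p.2 + inZp 1)%R).

Fact zrot_fun_inj : injective zrot_fun.
Proof.
move=> [k d] [l e] E; have /addIr /= -> := congr1 snd E.
by have /= -> := congr1 fst E.
Qed.

Definition zrot := perm zrot_fun_inj.

Lemma zrotX c p : (zrot ^+ c) p = (p.1, (p.2 + inZp c)%R).
Proof.
elim: c p => [|c IHc] [k d].
  by rewrite perm1; congr (_, _); apply/val_inj; rewrite /= addn0 modn_small.
rewrite expgSr permM IHc permE /zrot_fun /= -addrA; congr (_, (_ + _)%R).
by apply/val_inj; rewrite /= modnDm addn1.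
Qed.

(** A permutation that commutes with [zrot] is determined by its values at the points [(k, 0)]:
    their first coordinates give the permutation of ['I_n], their second ones the cyclic part. *)
Lemma wperm_zrot : wperm @* setT = 'C[zrot].
Proof.
apply/setP=> P; apply/morphimP/cent1P=> [[u _ _ ->]|zP].
  apply/permP=> p; rewrite !permM !wpermE !permE /zrot_fun.
  by case: u => [[a f] ?]; rewrite /wact /= addrAC.
have PE k d : P (k, d) = ((P (k, 0)).1, ((P (k, 0)).2 + d)%R).
  have -> : (k, d) = (zrot ^+ d) (k, 0%R) by rewrite zrotX /= add0r valZpK.
  by rewrite -permM -(commuteX d zP) permM zrotX valZpK.
(* If [P (k, 0)] and [P (l, 0)] lie in one fibre, then by [PE] the point [(l, d)], with [d] the
   difference of their second coordinates, has the same image as [(k, 0)]. *)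
have a_inj : injective (fun k => (P (k, 0)).1).
  move=> k l /= kl.
  suff [] : (k, 0%R) = (l, (P (k, 0)).2 - (P (l, 0)).2)%R by [].
  apply: (@perm_inj _ P); rewrite [RHS]PE -kl addrC subrK.
  by case: (P _).
pose a := perm a_inj; pose f : cycpow m n := [ffun k => (P (a^-1 k, 0%R)).2].
have af : (a, f) \in setX setT setT by rewrite !inE.
exists (SdPair (cycpow_groupAction m n) af); rewrite ?inE //.
apply/permP=> -[k d]; rewrite wpermE /wact /= ffunE permK permE PE /=.
by rewrite addrC.
Qed.

Definition zcentral_group w := (<[zrot]> <*> <[wperm w]>)%G.

Lemma wperm_commute_zrot w : commute zrot (wperm w).
Proof.
by apply/esym/cent1P; rewrite -wperm_zrot mem_morphim ?inE.
Qed.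

Lemma cycle_zrot_cent w : <[wperm w]> \subset 'C(<[zrot]>).
Proof.
by rewrite cycle_subG /= cent_cycle; apply/cent1P/esym/wperm_commute_zrot.
Qed.

Lemma zcentral_groupP w x :
  reflect (exists i j, x = zrot ^+ i * wperm w ^+ j) (x \in zcentral_group w).
Proof.
rewrite /= cent_joinEr ?cycle_zrot_cent //.
apply: (iffP mulsgP) => [[_ _ /cycleP[i ->] /cycleP[j ->] ->]|[i [j ->]]].
  by exists i, j.
by exists (zrot ^+ i) (wperm w ^+ j); rewrite ?mem_cycle.
Qed.

Lemma zcentral_group_abelian w : abelian (zcentral_group w).
Proof.
by rewrite abelianY !cycle_abelian cycle_zrot_cent.
Qed.

(** The embedding [wperm] carries ['C[w]] onto the intersection of ['C[zrot]], its whole image, with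
    ['C[wperm w]]. *)
Lemma card_wreath_cent1 w : #|'C[w]| = #|'C(zcentral_group w)|.
Proof.
rewrite -[in LHS](setTI 'C[w]) -(card_injm wperm_inj) ?subsetT //.
rewrite injm_subcent1 ?wperm_inj ?inE //.
by rewrite wperm_zrot centY !cent_cycle.
Qed.

End WreathPoints.

(** * Action of the generators and of the blocks on points *)

Section Blocks.

Local Open Scope group_scope.
Local Open Scope nat_scope.

Variables m n : nat.

Local Notation W := (wreath m n).
Local Notation wpoint := ('I_n * 'I_m.-1.+1)%type.
Implicit Types (p : wpoint) (b c a k : nat).

Lemma inZp_0 q : inZp 0 = 0%R :> 'I_q.+1.
Proof. by apply/val_inj; rewrite /= mod0n. Qed.

Lemma wactM_wpoint p (u v : W) : wact p (u * v)%g = wact (wact p u) v.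
Proof. exact: wactM. Qed.

Lemma wact_sdpair1 p (f : cycpow m n) :
  wact p (sdpair1 (cycpow_groupAction m n) f) = (p.1, (p.2 + f p.1)%R).
Proof. by rewrite /wact [pair_of_sd _]val_insubd !inE /= perm1. Qed.

Lemma wact_sdpair2 p (s : 'S_n) :
  wact p (sdpair2 (cycpow_groupAction m n) s) = (s p.1, p.2).
Proof. by rewrite /wact [pair_of_sd _]val_insubd !inE /= ffunE addr0. Qed.

Lemma wact_sgen1 p :
  wact p (sgen m n 1) = (p.1, (p.2 + inZp (p.1 == 0 :> nat))%R).
Proof. by rewrite wact_sdpair1 ffunE. Qed.

Lemma wact_sgen p j : j.+2 <= n ->
  (wact p (sgen m n j.+2)).2 = p.2 /\
  nat_of_ord (wact p (sgen m n j.+2)).1 =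
    if p.1 == j :> nat then j.+1 else if p.1 == j.+1 :> nat then j else p.1.
Proof.
move=> jn; rewrite /sgen /= !insubT // => [|lt_jn]; first exact: ltnW.
rewrite wact_sdpair2 /=; split=> //.
case: tpermP => [->|->|/eqP + /eqP]; rewrite /= ?eqxx ?(gtn_eqF (ltnSn j)) //.
by rewrite -!(inj_eq val_inj) /= => /negPf-> /negPf->.
Qed.

Lemma wpoint_eqP p (q : wpoint) : nat_of_ord p.1 = q.1 -> p.2 = q.2 -> p = q.
Proof. by case: p q => [k d] [l e] /= /val_inj -> ->. Qed.

Lemma wact_tgen p j : j < n ->
  wact p (tgen m n j.+1) = (p.1, (p.2 + inZp (p.1 == j :> nat))%R).
Proof.
elim: j p => [|j IHj] p jn; first exact: wact_sgen1.
rewrite /= -/(tgen m n j.+1) !wactM_wpoint IHj; last exact: ltnW.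
set q := wact p _; have [q2 q1] := wact_sgen p jn.
have [r2 r1] := wact_sgen (q.1, (q.2 + inZp (q.1 == j :> nat))%R) jn.
apply: wpoint_eqP; rewrite ?r1 ?r2 /= q1 ?q2; last first.
  congr (_ + inZp (nat_of_bool _))%R; move: (nat_of_ord p.1) => k.
  by case: (k =P j) => ?; case: (k =P j.+1) => ?; lia.
by move: (nat_of_ord p.1) => k; case: (k =P j) => ?; case: (k =P j.+1) => ? /=;
  do 2?[case: eqP => ? /=]; lia.
Qed.

Lemma wact_tgenX p j c : j < n ->
  wact p (tgen m n j.+1 ^+ c)%g =
    (p.1, (p.2 + inZp (if p.1 == j :> nat then c else 0)%N)%R).
Proof.
move=> jn; elim: c => [|c IHc].
  by rewrite [wact _ _]wact1; apply: wpoint_eqP;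
    rewrite //= if_same inZp_0 addr0.
rewrite expgSr wactM_wpoint IHc wact_tgen //= -addrA; congr (_, (_ + _)%R).
by apply: val_inj; rewrite /= modnDm; case: eqP; rewrite ?addn1.
Qed.

(** Here [a] is one less than the size of the part. The action is on the right, so the factor of
    largest index acts first: position [b + a] is carried down step by step to [b], and each
    position passed moves up by one. *)
Lemma wact_sgen_prod p b a : b + a < n ->
  let q := wact p (\prod_(j <- rev (iota b.+2 a)) sgen m n j)%g in
  q.2 = p.2 /\
  nat_of_ord q.1 = if p.1 == b + a :> nat then b
            else if b <= p.1 < b + a then p.1.+1 else p.1.
Proof.
elim: a p => [|a IHa] p ban q; rewrite {}/q.
  by rewrite big_nil [wact _ _]wact1; split=> //; do 2?[case: ifP => ?]; lia.
rewrite -[X in iota _ X]addn1 iotaD cats1 rev_rcons big_cons wactM_wpoint.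
have [|r2 r1] := @wact_sgen p (b + a); first by rewrite addnS in ban.
rewrite !addSn; have [|-> ->] := IHa (wact p (sgen m n (b + a).+2)); first lia.
rewrite r1 r2; split=> //; move: (nat_of_ord p.1) => k.
case: (k =P b + a) => ?; case: (k =P (b + a).+1) => ? /=;
  do 4?[case: ifP => ? /=]; lia.
Qed.

Lemma wact_wblock p b c a : 0 < a -> b + a <= n ->
  (wact p (wblock m n b c a)).2 =
    (p.2 + inZp (if p.1 == (b + a).-1 :> nat then c else 0)%N)%R /\
  nat_of_ord (wact p (wblock m n b c a)).1 =
    if p.1 == (b + a).-1 :> nat then b
    else if b <= p.1 < (b + a).-1 then p.1.+1 else p.1.
Proof.
case: a => // a _; rewrite addnS => ban.
rewrite /wblock addnS wactM_wpoint wact_tgenX //.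
set d := (p.2 + _)%R; by have [-> ->] := wact_sgen_prod (p.1, d) ban.
Qed.

Definition bsize (s : seq (nat * nat)) := sumn (unzip2 s).

Lemma bsize_cons l s : bsize (l :: s) = l.2 + bsize s.
Proof. by []. Qed.

Lemma wact_wblocks_lt p b s : all (fun l => 0 < l.2) s -> b + bsize s <= n ->
  p.1 < b -> wact p (wblocks m n b s) = p.
Proof.
elim: s p b => [|[c a] s IHs] p b /=; first by rewrite [wact _ _]wact1.
case/andP=> a0 s0; rewrite bsize_cons /= addnA => sn pb.
rewrite wactM_wpoint [wact p _](_ : _ = p).
  by apply: IHs => //; exact: ltn_addr.
have [|] := @wact_wblock p b c a a0; first lia.
have -> : (p.1 == (b + a).-1 :> nat) = false by lia.
move=> w2 w1; apply: wpoint_eqP; rewrite ?w1 ?w2 /=.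
  by case: ifP => ?; lia.
by rewrite inZp_0 addr0.
Qed.

(** Earlier blocks fix [p], its own block keeps it within the same range of positions, and later
    blocks fix the image. *)
Lemma wact_wblocks p b s1 c a s2 :
    let s := s1 ++ (c, a) :: s2 in
    all (fun l => 0 < l.2) s -> b + bsize s <= n ->
    b + bsize s1 <= p.1 < b + bsize s1 + a ->
  wact p (wblocks m n b s) = wact p (wblock m n (b + bsize s1) c a).
Proof.
elim: s1 b => [|[c1 a1] s1 IHs] b /=.
  rewrite bsize_cons /= addn0 addnA => /andP[a0 s0] sn pa.
  rewrite wactM_wpoint wact_wblocks_lt //.
  have [|_ ->] := @wact_wblock p b c a a0; first lia.
  by do 2?[case: ifP => ?]; lia.
rewrite !bsize_cons /= !addnA => /andP[a0 s0] sn pa.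
rewrite wactM_wpoint [wact p _](_ : _ = p); first exact: IHs.
have [|] := @wact_wblock p b c1 a1 a0; first lia.
have -> : (p.1 == (b + a1).-1 :> nat) = false by lia.
move=> w2 w1; apply: wpoint_eqP; rewrite ?w1 ?w2 /=.
  by case: ifP => ?; lia.
by rewrite inZp_0 addr0.
Qed.

End Blocks.

(** * Cycle labels of points *)

Section CycleType.

Local Open Scope group_scope.
Local Open Scope nat_scope.

Variables m n : nat.

Local Notation wpoint := ('I_n * 'I_m.-1.+1)%type.
Local Notation M := m.-1.+1.
Implicit Types (p q : wpoint) (v P : {perm wpoint}) (l : nat * nat).

Local Notation zrot := (zrot m n).

(* The label (c, a) of a point: its cycle in 'I_n has length a, and running   *)
(* once through that cycle multiplies by the c-th power of the root of unity. *)
Definition cycle_type v p l :=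
  [/\ 0 < l.2, forall j, 0 < j < l.2 -> ((v ^+ j)%g p).1 != p.1
    & (v ^+ l.2)%g p = (zrot ^+ l.1)%g p].

Lemma zrot_fiberP p q : reflect (exists c, q = (zrot ^+ c)%g p) (q.1 == p.1).
Proof.
apply: (iffP eqP) => [qp|[c ->]]; last by rewrite zrotX.
exists (q.2 - p.2)%R; rewrite zrotX valZpK addrC subrK -qp.
by case: (q).
Qed.

Lemma commute_zrot_fst P p q : commute P zrot ->
  ((P q).1 == (P p).1) = (q.1 == p.1).
Proof.
move=> Pz; apply/zrot_fiberP/zrot_fiberP=> -[c].
  by rewrite -permM (commuteX c Pz) permM => /perm_inj; exists c.
by move=> ->; exists c; rewrite -!permM (commuteX c Pz).
Qed.

Lemma zrotX_fixed i p q : (zrot ^+ i)%g p = p -> (zrot ^+ i)%g q = q.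
Proof.
rewrite !zrotX => /(congr1 snd) /= /(canRL (addKr _)); rewrite addNr => ->.
by case: q => k d; rewrite addr0.
Qed.

(** The label is expressed through [v] and [zrot] alone, so conjugation by a permutation that
    commutes with [zrot] transports it. *)
Lemma cycle_typeJ v P p l : commute P zrot ->
  cycle_type v p l -> cycle_type (v ^ P)%g (P p) l.
Proof.
move=> Pz [a0 first_ret ret].
have vP j : ((v ^ P) ^+ j)%g (P p) = P ((v ^+ j)%g p).
  by rewrite -conjXg conjgE !permM permK.
split=> // [j jl|]; rewrite vP; first by rewrite commute_zrot_fst // first_ret.
by rewrite ret -!permM (commuteX _ Pz).
Qed.

Lemma cycle_type_commute v P p l : commute P zrot -> commute P v ->
  cycle_type v p l -> cycle_type v (P p) l.
Proof. by move=> Pz Pv /(cycle_typeJ Pz); rewrite conjgE -Pv mulKg. Qed.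

(** The second component is the time of first return to the fibre of [p]; the first is then
    determined modulo [M], hence exactly by the bounds. *)
Lemma cycle_type_inj v p l l' : l.1 < M -> l'.1 < M ->
  cycle_type v p l -> cycle_type v p l' -> l = l'.
Proof.
case: l l' => [c a] [c' a'] /= cM c'M [/= a0 fa ra] [/= a'0 fa' ra'].
have aa' : a = a'.
  have [lt_aa'|lt_a'a|//] := ltngtP a a'.
    by have /fa' : 0 < a < a'; [rewrite a0 | rewrite ra zrotX eqxx].
  by have /fa : 0 < a' < a; [rewrite a'0 | rewrite ra' zrotX eqxx].
subst a'; congr (_, _); move: ra; rewrite ra' !zrotX => /(congr1 snd) /= /addrI.
by move/(congr1 val); rewrite /= !modn_small.
Qed.

End CycleType.

(** * Stabilizers and orbits of the abelian group in terms of labels *)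

Section CycleTypeStab.

Local Open Scope group_scope.
Local Open Scope nat_scope.

Variables m n : nat.
Local Notation wpoint := ('I_n * 'I_m.-1.+1)%type.
Local Notation M := m.-1.+1.
Local Notation zrot := (zrot m n).

Variables (w : wreath m n) (lab : wpoint -> nat * nat).
Hypothesis labP : forall p, cycle_type (wperm w) p (lab p).
Hypothesis lab_ltM : forall p, (lab p).1 < M.

Local Notation A := (zcentral_group w).
Local Notation v := (wperm w).

Lemma wperm_zrotC i j : commute (v ^+ i)%g (zrot ^+ j)%g.
Proof. exact/commuteX2/commute_sym/wperm_commute_zrot. Qed.

Lemma wpermX_zrotX i j (p : wpoint) :
  (v ^+ i)%g ((zrot ^+ j)%g p) = (zrot ^+ j)%g ((v ^+ i)%g p).
Proof. by rewrite -!permM wperm_zrotC. Qed.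

Lemma cycle_size_gt0 p : 0 < (lab p).2. Proof. by case: (labP p). Qed.

Lemma zcentral_reduce p i j :
  (zrot ^+ i * v ^+ j)%g p =
  (zrot ^+ (i + (lab p).1 * (j %/ (lab p).2)) * v ^+ (j %% (lab p).2))%g p.
Proof.
have vX k : (v ^+ ((lab p).2 * k))%g p = (zrot ^+ ((lab p).1 * k))%g p.
  have [_ _ ra] := labP p; elim: k => [|k IHk]; first by rewrite !muln0.
  by rewrite !mulnS addnC !expgD !permM IHk wpermX_zrotX ra.
rewrite {1}(divn_eq j (lab p).2) [_ * (lab p).2]mulnC expgD mulgA -wperm_zrotC.
by rewrite !permM vX addnC expgD permM.
Qed.

(** In the normal form of [zcentral_reduce], a nonzero remainder would move [p] out of its fibre,
    which powers of [zrot] preserve. *)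
Lemma zcentral_stab p i j :
  (zrot ^+ i * v ^+ j)%g p = p <->
  j %% (lab p).2 = 0 /\ (zrot ^+ (i + (lab p).1 * (j %/ (lab p).2)))%g p = p.
Proof.
rewrite zcentral_reduce; split=> [|[-> //]]; last by rewrite mulg1.
have [->|r0] := posnP (j %% (lab p).2); first by rewrite mulg1.
set u := (zrot ^+ _)%g; rewrite permM => fixp.
have [_ /(_ (j %% (lab p).2)) + _] := labP p.
rewrite r0 ltn_mod cycle_size_gt0 => /(_ isT)/negP[].
rewrite eq_sym -[X in X.1 == _]fixp commute_zrot_fst.
  by apply/zrot_fiberP; eexists.
by rewrite -[zrot]expg1; apply: wperm_zrotC.
Qed.

(** By [zcentral_stab] the label determines the stabilizer, since a power of [zrot] fixing one point
    fixes all. Conversely, for [lab p = (c, a)] the element [zrot ^- c * v ^+ a] fixes [p], hence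
    [q], so [q] returns to its fibre after [a] steps; by symmetry the first return times agree. *)
Lemma lab_stab p q : lab p = lab q <-> 'C_A[p | 'P] = 'C_A[q | 'P].
Proof.
have memA p' i j : ((zrot ^+ i * v ^+ j)%g \in 'C_A[p' | 'P]) <->
    (zrot ^+ i * v ^+ j)%g p' = p'.
  split=> [/setIP[_ /astab1P]//|fix_p]; apply/setIP; split.
    by apply/zcentral_groupP; exists i, j.
  exact/astab1P.
split=> [lpq|spq].
  apply/setP=> x; case Ax: (x \in A); last by rewrite !inE Ax.
  case/zcentral_groupP: Ax => i [j ->].
  apply/idP/idP=> /memA/zcentral_stab; rewrite ?lpq => -[r0 fix_];
    apply/memA/zcentral_stab; rewrite ?lpq; split=> //; exact: zrotX_fixed fix_.
suff ret (p' q' : wpoint) : 'C_A[p' | 'P] = 'C_A[q' | 'P] ->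
    (v ^+ (lab p').2)%g q' = (zrot ^+ (lab p').1)%g q'.
  have le_lab (p' q' : wpoint) : 'C_A[p' | 'P] = 'C_A[q' | 'P] ->
      (lab q').2 <= (lab p').2.
    move=> /ret vq; rewrite leqNgt; apply/negP=> lt_qp.
    have [_ /(_ (lab p').2) + _] := labP q'.
    by rewrite cycle_size_gt0 lt_qp vq zrotX eqxx => /(_ isT).
  apply: (cycle_type_inj (v := v) (p := q)) => //; split.
  - exact: cycle_size_gt0.
  - move=> j /andP[j0 jp]; have [_ + _] := labP q; apply; rewrite j0.
    by rewrite (leq_trans jp) // le_lab.
  - exact: ret.
move=> spq'; have [_ _ rp] := labP p'.
(* The inverse of a power of [zrot], written with a natural exponent as [memA] requires. *)
have [k zk] : exists k, (zrot ^+ (lab p').1 * zrot ^+ k = 1)%g.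
  exists (#[zrot] * (lab p').1 - (lab p').1).
  rewrite -expgD subnKC ?expgM ?expg_order ?expg1n //.
  by rewrite leq_pmull ?order_gt0.
have /memA : (zrot ^+ k * v ^+ (lab p').2)%g p' = p'.
  by rewrite -wperm_zrotC permM rp -permM zk perm1.
rewrite spq' => /memA; rewrite -wperm_zrotC permM.
move/(congr1 (zrot ^+ (lab p').1)%g) <-.
by rewrite -permM -expgD addnC expgD zk perm1.
Qed.

(** Each point of the orbit is [zrot ^+ i * v ^+ j] applied to [p] for exactly one pair with [i < M]
    and [j < (lab p).2]. *)
Lemma card_zcentral_orbit p : #|orbit 'P A p| = M * (lab p).2.
Proof.
pose f (x : 'I_M * 'I_(lab p).2) := (zrot ^+ x.1 * v ^+ x.2)%g p.
have zv1 : commute v zrot by rewrite -[v]expg1 -[zrot]expg1; apply: wperm_zrotC.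
have fE x : (f x).1 = ((v ^+ x.2)%g p).1.
  by rewrite /f -wperm_zrotC permM zrotX.
have f_inj : injective f.
  move=> [i j] [i' j'] ff.
  have jj' : j = j' :> nat.
    (* Otherwise [v ^+ (j' - j)] would return [p] to its fibre before the first return time. *)
    wlog lt_jj' : i j i' j' ff / j < j'.
      move=> IH.
      by have [/(IH _ _ _ _ ff)|/(IH _ _ _ _ (esym ff))|] := ltngtP j j'.
    have := fE (i, j); rewrite ff fE /= -(subnKC (ltnW lt_jj')) addnC expgD.
    rewrite permM => /eqP; rewrite commute_zrot_fst; last first.
      exact/commute_sym/commuteX/commute_sym.
    have [_ fa _] := labP p; rewrite (negPf (fa _ _)) // subn_gt0 lt_jj'.
    by rewrite (leq_ltn_trans (leq_subr _ _)) ?ltn_ord.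
  move: ff; rewrite /f /= jj' -!wperm_zrotC !permM !zrotX.
  move=> /(congr1 snd) /= /addrI.
  by rewrite !valZpK => ->; congr (_, _); apply: val_inj.
transitivity #|codom f|; last by rewrite card_codom // card_prod !card_ord.
apply: eq_card => q; apply/orbitP/codomP=> [[_ /zcentral_groupP[i [j ->]] <-]|].
  rewrite /= /aperm zcentral_reduce; set k := (i + _); set r := j %% _.
  have lt_r : r < (lab p).2 by rewrite ltn_mod cycle_size_gt0.
  exists (inZp k, Ordinal lt_r); rewrite /f /= -!wperm_zrotC !permM !zrotX.
  by congr (_, (_ + _)%R); apply: val_inj; rewrite /= modn_mod.
case=> -[i j] ->; exists (zrot ^+ i * v ^+ j)%g => //.
by apply/zcentral_groupP; exists i, j.
Qed.

End CycleTypeStab.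

(** * Labels and centralizers of products of blocks *)

Section BlockLabels.

Local Open Scope group_scope.
Local Open Scope nat_scope.

Implicit Types (b k : nat) (l : nat * nat) (s : seq (nat * nat)).

(* The list element owning position k when blocks of sizes l.2 are laid out   *)
(* from b on; (0, 0) past the end.                                            *)
Fixpoint blab b s k : nat * nat :=
  if s is l :: s' then if k < b + l.2 then l else blab (b + l.2) s' k
  else (0, 0).

Lemma blabP b s k : b <= k < b + bsize s -> exists s1 s2,
  s = s1 ++ blab b s k :: s2 /\
  b + bsize s1 <= k < b + bsize s1 + (blab b s k).2.
Proof.
elim: s b => [|l s IHs] b; first by rewrite addn0; case: ltnP.
rewrite bsize_cons addnA /= => /andP[bk ks].
have [kl|lk] := ltnP k (b + l.2).
  by exists [::], s; rewrite addn0 bk.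
have [|s1 [s2 [sE sk]]] := IHs (b + l.2); first by rewrite lk.
by exists (l :: s1), s2; rewrite bsize_cons addnA; split=> //=; congr (_ :: _).
Qed.

Lemma count_blab b s l :
  count (fun k => blab b s k == l) (iota b (bsize s)) = count_mem l s * l.2.
Proof.
elim: s b => //= l' s IHs b.
rewrite bsize_cons iotaD count_cat mulnDl -(IHs (b + l'.2)).
congr (_ + _); last first.
  apply: eq_in_count => k; rewrite mem_iota => /andP[+ _].
  by rewrite leqNgt => /negPf->.
case: eqP => [<-|/eqP nl]; last first.
  rewrite mul0n -(count_pred0 (iota b l'.2)).
  apply: eq_in_count => k; rewrite mem_iota => /andP[_ ->].
  exact/negbTE.
rewrite mul1n -[RHS](size_iota b) -count_predT.
by apply: eq_in_count => k; rewrite mem_iota => /andP[_ ->]; rewrite eqxx.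
Qed.

Variables m n : nat.
Local Notation M := m.-1.+1.
Local Notation wpoint := ('I_n * 'I_m.-1.+1)%type.

Variable s : seq (nat * nat).
Hypothesis s_gt0 : all (fun l => 0 < l.2) s.
Hypothesis s_size : bsize s = n.

Lemma cycle_type_wblocks (p : wpoint) :
  cycle_type (wperm (wblocks m n 0 s)) p (blab 0 s p.1).
Proof.
have [|s1 [s2 [sE]]] := @blabP 0 s p.1; first by rewrite s_size ltn_ord.
case: (blab 0 s p.1) sE => c a sE /=; rewrite add0n => pk.
have a0 : 0 < a.
  by move: s_gt0; rewrite sE all_cat /= => /and3P[].
set b := bsize s1 in pk; have ban : b + a <= n.
  rewrite -s_size sE /bsize /unzip2 map_cat sumn_cat /=.
  by rewrite leq_add2l leq_addr.
set v := wperm _.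
have vE (q : wpoint) : b <= q.1 < b + a -> v q = wact q (wblock m n b c a).
  move=> qb; rewrite wpermE sE -[b]add0n; apply: wact_wblocks.
  - by rewrite -sE.
  - by rewrite -sE s_size.
  - by rewrite !add0n.
have lt_bn : b < n by rewrite (leq_trans _ ban) // -addn1 leq_add2l.
(* The twist by [c] occurs only on the step that closes the cycle, so [p] is reached from the point
   [q] over the first position of its block with the second coordinate unchanged. It is enough to
   label [q], as powers of [v] preserve labels. *)
pose q : wpoint := (Ordinal lt_bn, p.2).
have vXq j : j < a ->
    nat_of_ord ((v ^+ j)%g q).1 = b + j /\ ((v ^+ j)%g q).2 = p.2.
  elim: j => [|j IHj] ja; first by rewrite perm1 addn0.
  have [IH1 IH2] := IHj (ltnW ja); set u := (v ^+ j)%g q in IH1 IH2.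
  rewrite expgSr permM -/u vE ?IH1; last by rewrite leq_addr ltn_add2l ltnW.
  have [-> ->] := wact_wblock u c a0 ban; rewrite IH1 IH2.
  have -> : (b + j == (b + a).-1) = false by lia.
  have -> : b <= b + j < (b + a).-1 by lia.
  by rewrite inZp_0 addr0 addnS.
have [vq1 vq2] := vXq a.-1 (ltac:(by rewrite prednK)).
have q_type : cycle_type v q (c, a).
  split=> // [j /= /andP[j0 ja]|/=].
    apply/eqP=> /(congr1 val) /=; have [-> _] := vXq j ja; lia.
  rewrite -{1}(prednK a0) expgSr permM.
  set u := (v ^+ a.-1)%g q in vq1 vq2 *.
  rewrite vE ?vq1; last by lia.
  have [w2 w1] := wact_wblock u c a0 ban.
  have ue : (b + a.-1 == (b + a).-1) = true by lia.
  by apply: wpoint_eqP; rewrite zrotX ?w1 ?w2 vq1 ue //= vq2.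
have lt_pa : p.1 - b < a by lia.
have -> : p = (v ^+ (p.1 - b))%g q.
  by have [v1 v2] := vXq _ lt_pa; apply: wpoint_eqP; rewrite ?v1 ?v2 //; lia.
apply: cycle_type_commute q_type.
  exact/commute_sym/commuteX/wperm_commute_zrot.
exact/commute_sym/commuteX.
Qed.

Lemma card_blab l :
  #|[set p : wpoint | blab 0 s p.1 == l]| = count_mem l s * (M * l.2).
Proof.
rewrite mulnCA -(count_blab 0) s_size mulnC.
transitivity #|setX [set k : 'I_n | blab 0 s k == l] [set: 'I_M]|.
  by apply: eq_card => p; rewrite !inE andbT.
rewrite cardsX cardsT card_ord; congr (_ * _).
by rewrite cardsE cardE /enum_mem size_filter -val_enum_ord count_map enumT.
Qed.

Hypothesis s_ltM : all (fun l => l.1 < M) s.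

Lemma blab_ltM (p : wpoint) : (blab 0 s p.1).1 < M.
Proof.
have [|s1 [s2 [sE _]]] := @blabP 0 s p.1; first by rewrite s_size ltn_ord.
by move: s_ltM; rewrite {1}sE all_cat /= => /and3P[].
Qed.

Lemma card_cent_wblocks L0 : uniq L0 -> {subset s <= L0} ->
  #|'C[wblocks m n 0 s]%g| =
  (\prod_(l <- s) (M * l.2)) * \prod_(l <- L0) (count_mem l s)`!.
Proof.
move=> uL0 sL0; rewrite card_wreath_cent1.
pose lab (p : wpoint) := blab 0 s p.1.
apply: (@card_cent_abelian_perm _ _ _ _ lab (fun l => M * l.2)) => //.
- exact: zcentral_group_abelian.
- exact: lab_stab cycle_type_wblocks blab_ltM.
- exact: card_zcentral_orbit cycle_type_wblocks.
- exact: card_blab.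
- by move=> l /(allP s_gt0); rewrite muln_gt0.
Qed.

End BlockLabels.

(** The conjugating element maps the points labelled [l] for [s'] bijectively onto those for [s];
    the positive factor [m.-1.+1 * l.2] is then cancelled from the two counts of points. *)
Lemma wblocks_conj_count m n (s s' : seq (nat * nat)) (l : nat * nat) :
    all (fun l => 0 < l.2)%N s -> all (fun l => 0 < l.2)%N s' ->
    bsize s = n -> bsize s' = n ->
    all (fun l => l.1 < m.-1.+1)%N s -> all (fun l => l.1 < m.-1.+1)%N s' ->
    (wblocks m n 0 s \in wblocks m n 0 s' ^: [set: wreath m n])%g ->
  (0 < l.2)%N -> count_mem l s = count_mem l s'.
Proof.
move=> s0 s'0 sn s'n sM s'M /imsetP[x _ sx] l0.
have := card_blab m s'n l; have := card_blab m sn l.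
have lab_x (p : 'I_n * 'I_m.-1.+1) :
    blab 0 s (wperm x p).1 = blab 0 s' p.1.
  apply: (cycle_type_inj (v := wperm (wblocks m n 0 s)) (p := wperm x p)).
  - exact: blab_ltM.
  - exact: blab_ltM.
  - exact: cycle_type_wblocks.
  rewrite sx morphJ ?inE //; apply: cycle_typeJ.
    exact/commute_sym/wperm_commute_zrot.
  exact: cycle_type_wblocks.
have <- : wperm x @^-1: [set p : 'I_n * 'I_m.-1.+1 | blab 0 s p.1 == l] =
          [set p : 'I_n * 'I_m.-1.+1 | blab 0 s' p.1 == l].
  by apply/setP=> p; rewrite !inE lab_x.
rewrite card_preimset; last exact: perm_inj.
by move=> -> /eqP; rewrite eqn_pmul2r ?muln_gt0 // => /eqP.
Qed.

(** * Multipartitions: the centralizer order and separation of classes *)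

Section MultipartitionBlocks.

Local Open Scope nat_scope.

Variables m n : nat.
Hypothesis m_gt0 : 0 < m.
Implicit Types mu nu : mpartition n m.

Definition mpart_blocks mu : seq (nat * nat) :=
  [seq (val i, a) | i <- enum 'I_m, a <- tnth mu i].

Lemma mpartP mu i : is_partition (tnth mu i).
Proof. by case: mu => mu /= /andP[/all_tnthP/(_ i)]. Qed.

Lemma count_mpart_blocks mu (i : 'I_m) a :
  count_mem (val i, a) (mpart_blocks mu) = count_mem a (tnth mu i).
Proof.
rewrite -!sum1_count big_mkcond big_allpairs_dep big_enum /= (bigD1 i) //=.
rewrite [X in _ + X]big1 ?addn0 => [|j /negPf ji].
  by rewrite [RHS]big_mkcond; apply: eq_bigr => b _; rewrite xpair_eqE eqxx.
by rewrite big1 // => b _; rewrite xpair_eqE (inj_eq val_inj) ji.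
Qed.

Lemma bsize_mpart_blocks mu : bsize (mpart_blocks mu) = n.
Proof.
rewrite /bsize sumnE big_map big_allpairs_dep big_enum /=.
case: mu => mu /= /andP[_ /eqP <-].
by apply: eq_bigr => i _; rewrite sumnE.
Qed.

Lemma mpart_blocks_gt0 mu : all (fun l => 0 < l.2) (mpart_blocks mu).
Proof.
apply/allP=> _ /allpairsPdep[i [a [_ ai ->]]] /=; rewrite lt0n.
by case/andP: (mpartP mu i) => _; apply: contraNneq => <-.
Qed.

Lemma mpart_blocks_ltm mu : all (fun l => l.1 < m.-1.+1) (mpart_blocks mu).
Proof.
apply/allP=> _ /allpairsPdep[i [a [_ _ ->]]] /=.
by rewrite prednK.
Qed.

Lemma prodn_count_mem (p : seq nat) (b : nat) :
    {in p, forall a, 0 < a < b} ->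
  \prod_(a <- p) a = \prod_(1 <= i < b) i ^ count_mem i p.
Proof.
elim: p => [|a p IHp] pb; first by rewrite big_nil big1_eq.
rewrite big_cons IHp => [|c pc]; last by apply: pb; rewrite inE pc orbT.
rewrite [RHS](eq_bigr (fun i => i ^ (a == i) * i ^ count_mem i p)) => [|i _].
  rewrite big_split /=; congr (_ * _).
  rewrite (bigD1_seq a) ?iota_uniq ?mem_index_iota ?pb ?mem_head //= eqxx.
  by rewrite big1 ?muln1 // => i; rewrite eq_sym => /negPf->.
by rewrite -expnD.
Qed.

(** This separates the factor due to orbit sizes from the factor due to permuting equal orbits, as
    in [card_cent_wblocks]. *)
Lemma zpartE (p : seq nat) : is_partition p ->
  zpart p = (\prod_(a <- p) a) * \prod_(1 <= i < (sumn p).+1) (count_mem i p)`!.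
Proof.
move=> p_part; rewrite /zpart big_split /= -prodn_count_mem // => a ap.
have [_ /(_ a ap)] := partition_bounds p_part; rewrite ltnS => ->.
by rewrite andbT lt0n; case/andP: p_part => _; apply: contraNneq => <-.
Qed.

Lemma card_cent_wmu mu :
  #|'C[wmu mu]%g| = m ^ mlength mu * \prod_(i < m) zpart (tnth mu i).
Proof.
(* The labels are taken over the index range of [zpart], so the factorials match term by term;
   labels that do not occur contribute 1. *)
pose L0 := [seq (val i, a) | i <- enum 'I_m,
                             a <- index_iota 1 (sumn (tnth mu i)).+1].
rewrite [LHS](@card_cent_wblocks m n (mpart_blocks mu) _ _ _ L0); first last.
- move=> _ /allpairsPdep[i [a [ei ai ->]]]; apply/allpairsPdep.
  exists i, a; split=> //; rewrite mem_index_iota ltnS.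
  have [_ /(_ a ai)->] := partition_bounds (mpartP mu i).
  by rewrite andbT lt0n; case/andP: (mpartP mu i) => _; apply: contraNneq => <-.
- apply: allpairs_uniq_dep => [|i _|]; first exact: enum_uniq.
    exact: iota_uniq.
  by move=> [i a] [j b] _ _ /= [/val_inj -> ->].
- exact: mpart_blocks_ltm.
- exact: bsize_mpart_blocks.
- exact: mpart_blocks_gt0.
rewrite !big_allpairs_dep !big_enum /= prednK // /mlength expn_sum.
rewrite -!big_split /=; apply: eq_bigr => i _.
rewrite zpartE ?mpartP // mulnA big_split /=; congr (_ * _ * _).
  by rewrite big_const_seq count_predT -Monoid.iteropE.
by apply: eq_bigr => a _; rewrite count_mpart_blocks.
Qed.

(** Conjugacy forces equal multiplicities of each part in each component, and a partition, being
    sorted, is determined by its multiplicities. *)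
Lemma wmu_conj_inj mu nu :
  (wmu mu \in wmu nu ^: [set: wreath m n])%g -> mu = nu.
Proof.
move=> conj_mu_nu; apply: val_inj; apply: eq_from_tnth => i.
have /andP[mu_sorted mu0] := mpartP mu i.
have /andP[nu_sorted nu0] := mpartP nu i.
apply: (sorted_eq (leT := geq)) => //.
- by move=> a b c ba ac; apply: leq_trans ac ba.
- by move=> a b; rewrite -eqn_leq eq_sym => /eqP.
apply/allP=> a; rewrite mem_cat => a_in /=.
rewrite -!count_mpart_blocks; apply/eqP.
apply: wblocks_conj_count conj_mu_nu _;
  rewrite ?mpart_blocks_gt0 ?bsize_mpart_blocks ?mpart_blocks_ltm //=.
rewrite lt0n; case/orP: a_in; apply: contraTneq => ->; by [].
Qed.

End MultipartitionBlocks.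

Theorem theorem8p4 (m n : nat) (m_gt0 : (0 < m)%N) (n_gt0 : (0 < n)%N)
    (phi : mpartition n m -> 'CF([set: wreath m n]))
    (phi_inj : injective phi) (phi_irr : codom phi =i irr [set: wreath m n])
    (mu nu : mpartition n m) :
  mbtr1 mu nu = \sum_(lam : mpartition n m)
                   phi lam (wmu mu) * (phi lam (wmu nu))^*
  /\ \sum_(lam : mpartition n m) phi lam (wmu mu) * (phi lam (wmu nu))^*
     = (mu == nu)%:R
       * (m ^ mlength mu * \prod_(i < m) zpart (tnth mu i))%N%:R.
Proof.
pose G := [set: wreath m n].
have sumE :
    \sum_(lam : mpartition n m) phi lam (wmu mu) * (phi lam (wmu nu))^* =
    #|'C[wmu mu]%g|%:R *+ (wmu mu \in wmu nu ^: G)%g.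
  rewrite -['C[_]%g]setTI -second_orthogonality_relation ?inE //.
  (* As [phi] lists the irreducible characters without repetition, the sum over [lam] reindexes that
     of the second orthogonality relation. *)
  have irr_phi : perm_eq (irr G) (codom phi).
    apply: uniq_perm => [||f]; [exact/free_uniq/irr_free | | by rewrite phi_irr].
    by rewrite codomE map_inj_uniq ?enum_uniq.
  pose F (f : 'CF(G)) := f (wmu mu) * (f (wmu nu))^*.
  transitivity (\sum_(f <- irr G) F f).
    by rewrite (perm_big _ irr_phi) codomE big_map big_enum.
  by rewrite big_tuple; apply: eq_bigr => i _; rewrite (tnth_nth 0).
rewrite /mbtr1 bimul_trace sumE; split=> //.
rewrite -card_cent_wmu // mulr_natl; congr (_ *+ nat_of_bool _).
by apply/idP/eqP=> [/wmu_conj_inj-> // | ->]; apply: class_refl.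
Qed.
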